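(* Let $\mathcal{G}=(V,E)$ be a finite, simple, connected, undirected graph with privacy function $\varepsilon:E\to[0,\infty)$, and count arithmetic operations and comparisons of real numbers (including evaluations of $f_\varepsilon$) as unit cost. Then Algorithm 1 runs in time $\mathcal{O}(|E|\,|V|)$ and Algorithm 2 runs in time $\mathcal{O}(|V|^3|E|)$, where these algorithms are as follows. Algorithm 1 (input $u\in V$, $\alpha\in[0,1]$; output $A_{u,\alpha}:V\to[0,1]$): set $S_1=\{u\}$, $A_{u,\alpha}(u)=\alpha$, $i=1$; while $|S_i|<|V|$: for each $v\in N(S_i)$ set $\alpha^*(v)=\min_{v'\in N(v)\cap S_i}f_{\varepsilon(v',v)}(A_{u,\alpha}(v'))$; choose $v_i\in\arg\min_{v\in N(S_i)}\alpha^*(v)$, set $A_{u,\alpha}(v_i)=\alpha^*(v_i)$, $S_{i+1}=S_i\cup\{v_i\}$, $i\leftarrow i+1$. Algorithm 2 (input $T:V\to\{1,2\}$, a set $S\subseteq V$ containing $\partial_T(\mathcal{G})$, and $p:S\to[0,1]$; output $\tilde p:V\to[0,1]$ or a failure message): test whether $p$ is compatible, i.e. whether $p(v)\le A_{u,p(u)}(v)$ for all ordered pairs of distinct $u,v\in S$, by calling Algorithm 1 for each such ordered pair; if not, output ''no $\varepsilon(\cdot)$-DP extension of $p$ exists''. Otherwise set $\tilde p(v)=p(v)$ for $v\in S$, and for each $v\in V\setminus S$ set $\tilde p(v)=\min_{u\in S}A_{u,p(u)}(v)$ if $T(v)=1$ and $\tilde p(v)=1-\min_{u\in S}A_{u,1-p(u)}(v)$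 if $T(v)=2$, computing each $A_{u,\cdot}(v)$ by a call of Algorithm 1.
   Context: For $A\subseteq V$, $N(A)$ is the set of vertices of $V\setminus A$ adjacent to some vertex of $A$, and $N(v)=N(\{v\})$. For $\varepsilon\ge0$ and $y\in[0,1]$, $f_\varepsilon(y)=\min\{e^{\varepsilon}y,\ (y-1+e^{\varepsilon})/e^{\varepsilon}\}$. The boundary set is $\partial_T(\mathcal{G})=\{u\in V:\exists v\in N(u),\ T(v)\ne T(u)\}$. *)

(* Defs.v *)
From HB Require Import structures.
From mathcomp Require Import all_boot all_order all_algebra.
From mathcomp Require Import reals sequences exp.
Set Implicit Arguments.
Unset Strict Implicit.
Unset Printing Implicit Defensive.
Import Order.TTheory GRing.Theory Num.Theory.
Local Open Scope ring_scope.

Section Graph.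
Variables (V : finType) (adj : rel V).

Definition edges : {set {set V}} :=
  [set [set xy.1; xy.2] | xy : V * V & adj xy.1 xy.2].

Definition connected_graph : Prop := forall x y : V, connect adj x y.

Definition nbhd (A : {set V}) : {set V} :=
  [set v in ~: A | [exists w in A, adj w v]].

Definition boundary (T : V -> nat) : {set V} :=
  [set u | [exists v in nbhd [set u], T v != T u]].

(* The adjacency list of v, which is part of the representation of the input
   graph. *)
Definition adj_list (v : V) : seq V := enum (adj v).

End Graph.

Definition fdp (R : realType) (eps y : R) : R :=
  Num.min (expR eps * y) ((y - 1 + expR eps) / expR eps).

(* A computation of type [comp A] is run with a bound ("fuel") on the number of
   iterations of each of its while loops. It yields its result together with
   the number of elementary operations performed, or None if it gets stuck or
   some loop exceeds the bound. *)
Definition comp (A : Type) := nat -> option (A * nat).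

Definition ret (A : Type) (a : A) : comp A := fun _ => Some (a, 0%N).

Definition bind (A B : Type) (m : comp A) (k : A -> comp B) : comp B :=
  fun fuel =>
    if m fuel is Some (a, c) then
      if k a fuel is Some (b, d) then Some (b, (c + d)%N) else None
    else None.

Definition stuck (A : Type) : comp A := fun _ => None.

(* [op a] obtains the value a by one unit-cost elementary operation: an
   arithmetic operation or comparison on reals, an evaluation of [fdp], a
   comparison or increment of a counter or index, or an access to one cell of
   an array. *)
Definition op (A : Type) (a : A) : comp A := fun _ => Some (a, 1%N).

Notation "'let*' x := m 'in' k" := (bind m (fun x => k))
  (at level 200, x name, m at level 100, k at level 200, right associativity).

(* Arrays indexed by V: allocation costs one unit per cell, reading or writing
   a cell costs one unit. A subset of V is stored as an array of bits, and is
   kept as a [{set V}] with the same costs. *)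
Definition new_array (V : finType) (X : Type) (x : X) : comp (V -> X) :=
  fun _ => Some (fun _ => x, #|V|).

Definition new_set (V : finType) : comp {set V} := fun _ => Some (set0, #|V|).

Definition read (V X : Type) (t : V -> X) (v : V) : comp X := op (t v).

Definition write (V : finType) (X : Type) (t : V -> X) (v : V) (x : X) :
    comp (V -> X) :=
  op (fun w => if w == v then x else t w).

(* One unit for each element of s, and one for detecting the end of s. *)
Fixpoint foreach (I A : Type) (s : seq I) (a : A) (body : I -> A -> comp A) :
    comp A :=
  if s is i :: s' then
    let* j := op i in
    let* b := body j a in
    foreach s' b body
  else op a.

Fixpoint while_fuel (A : Type) (guard : A -> comp bool) (body : A -> comp A)
    (n : nat) (a : A) : comp A :=
  if n is n'.+1 then
    let* b := guard a in
    if b then let* a' := body a in while_fuel guard body n' a' else ret a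
  else @stuck A.

Definition while (A : Type) (guard : A -> comp bool) (body : A -> comp A)
    (a : A) : comp A :=
  fun fuel => while_fuel guard body fuel a fuel.

Definition runs_within (A : Type) (m : comp A) (bound : nat) : Prop :=
  exists fuel a c, m fuel = Some (a, c) /\ (c <= bound)%N.

Section Algorithms.
Variables (R : realType) (V : finType) (adj : rel V) (eps : {set V} -> R).

(* Minimum of y and of the values met so far, None standing for no value. *)
Definition update_min (m : option R) (y : R) : comp (option R) :=
  if m is Some z then
    let* lt := op (y < z) in
    ret (Some (if lt then y else z))
  else ret (Some y).

(* alpha^*(v), or None if v has no neighbour in S. *)
Definition alpha_star (S : {set V}) (A : V -> R) (v : V) : comp (option R) :=
  foreach (adj_list adj v) None (fun w m =>
    let* inS := op (w \in S) in
    if inS then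
      let* e := op (eps [set w; v]) in
      let* a := read A w in
      let* y := op (fdp e a) in
      update_min m y
    else ret m).

(* The array of the values alpha^*(v) for v in N(S); the other entries are
   None. *)
Definition all_alpha_star (S : {set V}) (A : V -> R) : comp (V -> option R) :=
  let* astar := @new_array V (option R) None in
  foreach (enum V) astar (fun v astar =>
    let* inS := op (v \in S) in
    if inS then ret astar else
      let* m := alpha_star S A v in
      write astar v m).

(* How ties between minimizers are resolved: when S is the current set, the
   later scanned minimizer v replaces the minimizer w iff [tie S w v]. As S
   grows at each iteration, every sequence of choices of minimizers is obtained
   for some [tie]. *)
Definition tie_rule := {set V} -> rel V.

Definition argmin (tie : tie_rule) (S : {set V}) (astar : V -> option R) :
    comp (option (V * R)) :=
  foreach (enum V) None (fun v best =>
    let* x := read astar v in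
    match x, best with
    | None, _ => ret best
    | Some a, None => ret (Some (v, a))
    | Some a, Some (w, b) =>
        let* lt := op (a < b) in
        let* eq := op (a == b) in
        ret (if lt || eq && tie S w v then Some (v, a) else best)
    end).

(* The loop state consists of S_i, the array A and i = |S_i|; the array is
   meaningful on S_i only. *)
Definition alg1_body (tie : tie_rule) (st : {set V} * (V -> R) * nat) :
    comp ({set V} * (V -> R) * nat) :=
  let: (Si, A, i) := st in
  let* astar := all_alpha_star Si A in
  let* best := argmin tie Si astar in
  if best is Some (v, a) then
    let* A' := write A v a in
    let* S' := op (v |: Si) in
    let* i' := op i.+1 in
    ret (S', A', i')
  else @stuck _.

Definition alg1 (tie : tie_rule) (u : V) (alpha : R) : comp (V -> R) :=
  let* S0 := new_set V in
  let* S := op (u |: S0) in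
  let* A0 := @new_array V R 0 in
  let* A := write A0 u alpha in
  let* i := op 1%N in
  let* st := while (fun st => op (st.2 < #|V|)%N) (alg1_body tie) (S, A, i) in
  ret st.1.2.

(* The calls of [alg1] are indexed by pairs (u, v), and may resolve ties
   differently. *)
Definition compatible (tie : V -> V -> tie_rule) (S : {set V}) (p : V -> R) :
    comp bool :=
  foreach (enum S) true (fun u ok =>
    foreach (enum S) ok (fun v ok =>
      let* neq := op (u != v) in
      if neq then
        let* pu := read p u in
        let* A := alg1 (tie u v) u pu in
        let* pv := read p v in
        let* x := read A v in
        let* le := op (pv <= x) in
        ret (ok && le)
      else ret ok)).

(* The minimum over u in S of A_{u, alpha(u)}(v), where alpha(u) is computed by
   [alpha u]. A minimum over the empty set is 1, the top of [0, 1]. *)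
Definition min_over (tie : V -> V -> tie_rule) (S : {set V})
    (alpha : V -> comp R) (v : V) : comp R :=
  let* m := foreach (enum S) None (fun u m =>
    let* a := alpha u in
    let* A := alg1 (tie u v) u a in
    let* x := read A v in
    update_min m x) in
  ret (odflt 1 m).

(* The result None is the failure message. *)
Definition alg2 (tie : V -> V -> tie_rule) (T : V -> nat) (S : {set V})
    (p : V -> R) : comp (option (V -> R)) :=
  let* ok := compatible tie S p in
  if ok then
    let* pt0 := @new_array V R 0 in
    let* pt := foreach (enum V) pt0 (fun v pt =>
      let* inS := op (v \in S) in
      if inS then
        let* x := read p v in
        write pt v x
      else
        let* one := op (T v == 1%N) in
        if one then
          let* m := min_over tie S (fun u => read p u) v in
          write pt v m
        else
          let* m := min_over tie S
            (fun u => let* pu := read p u in op (1 - pu)) v in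
          let* x := op (1 - m) in
          write pt v x) in
    ret (Some pt)
  else ret None.

End Algorithms.

(* Main.v *)
(* Each iteration of Algorithm 1 scans every adjacency list once, at cost
   O(|V| + sum of the degrees) = O(|V| + |E|). By connectedness N(S_i) is
   nonempty while S_i <> V, so the loop adds one vertex per iteration and stops
   after |V| - 1 of them. When |V| >= 2, no vertex is isolated, so
   |V| <= 2|E|, and the total is O(|E||V|). Algorithm 2 makes at most
   2|V|^2 calls of Algorithm 1. *)
Require Import Defs.
From mathcomp Require Import all_boot all_order all_algebra.
From mathcomp Require Import reals sequences exp.
From mathcomp Require Import zify.
Set Implicit Arguments.
Unset Strict Implicit.
Unset Printing Implicit Defensive.
Import Order.TTheory GRing.Theory Num.Theory.
Local Open Scope ring_scope.

(** * A Hoare logic for total correctness with cost bounds *)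

Section CostLogic.
Local Open Scope nat_scope.
Variable fuel : nat.

(** A Hoare triple whose precondition lives in the context. The fuel is fixed for the section
    because all loops of a program receive the same one; the cost is only bounded above, so branches
    of different cost can share a bound. *)
Definition within (A : Type) (m : Defs.comp A) (c : nat) (Q : A -> Prop) : Prop :=
  exists a d, [/\ m fuel = Some (a, d), d <= c & Q a].

Lemma within_runs A (m : Defs.comp A) c c' Q :
  within m c Q -> c <= c' -> runs_within m c'.
Proof.
by move=> [a [d [ma dc _]]] cc'; exists fuel, a, d; split=> //; apply: leq_trans cc'.
Qed.

Lemma within_weaken A (m : Defs.comp A) c c' (P Q : A -> Prop) :
  within m c P -> c <= c' -> (forall a, P a -> Q a) -> within m c' Q.
Proof.
move=> [a [d [ma dc Pa]]] cc' PQ; exists a, d; split=> //; last exact: PQ.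
exact: leq_trans cc'.
Qed.

Lemma within_ret A (a : A) c (Q : A -> Prop) : Q a -> within (ret a) c Q.
Proof. by move=> Qa; exists a, 0. Qed.

Lemma within_op A (a : A) c (Q : A -> Prop) : Q a -> within (op a) c.+1 Q.
Proof. by move=> Qa; exists a, 1. Qed.

Lemma within_bind A B (m : Defs.comp A) (k : A -> Defs.comp B) c d (P : A -> Prop) Q :
  within m c P -> (forall a, P a -> within (k a) d Q) ->
  within (bind m k) (c + d) Q.
Proof.
move=> [a [x [ma xc Pa]]] /(_ a Pa) [b [y [kb yd Qb]]].
by exists b, (x + y); rewrite /bind ma kb; split=> //; apply: leq_add.
Qed.

Lemma within_bind_op A B (a : A) (k : A -> Defs.comp B) c Q :
  within (k a) c Q -> within (bind (op a) k) c.+1 Q.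
Proof.
move=> ka; rewrite -add1n; apply: (@within_bind _ _ _ _ _ _ (eq a)).
  exact: within_op.
by move=> _ <-.
Qed.

(* The invariant is indexed by the list of the elements still to be scanned. *)
Lemma within_foreach (I A : Type) (Inv : seq I -> A -> Prop)
    (body : I -> A -> Defs.comp A) (f : I -> nat) (s : seq I) (a : A) :
  (forall i s' b, Inv (i :: s') b -> within (body i b) (f i) (Inv s')) ->
  Inv s a -> within (foreach s a body) (\sum_(i <- s) (f i).+1).+1 (Inv [::]).
Proof.
move=> step; elim: s a => [|i s IHs] a Ia /=; first exact: within_op.
rewrite big_cons addSn; apply: within_bind_op; rewrite -addnS.
exact: within_bind (step _ _ _ Ia) IHs.
Qed.

Lemma within_foreach_const (I A : Type) (Inv : seq I -> A -> Prop)
    (body : I -> A -> Defs.comp A) (c : nat) (s : seq I) (a : A) :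
  (forall i s' b, Inv (i :: s') b -> within (body i b) c (Inv s')) ->
  Inv s a -> within (foreach s a body) (size s * c.+1).+1 (Inv [::]).
Proof.
move=> step Ia; have := within_foreach step Ia.
by rewrite big_const_seq count_predT iter_addn_0 mulnC.
Qed.

(** The variant [mu] bounds the number of iterations, each costing [c] plus one for the guard; the
    extra unit pays for the last, failing guard. That test also uses fuel, hence the strict
    [mu a < fuel]. *)
Lemma within_while (A : Type) (Inv : A -> Prop) (mu : A -> nat)
    (guard : A -> bool) (body : A -> Defs.comp A) (c : nat) (a : A) :
  (forall b, Inv b -> guard b ->
     within (body b) c (fun b' => Inv b' /\ mu b' < mu b)) ->
  Inv a -> mu a < fuel ->
  within (while (fun b => op (guard b)) body a) (mu a * c.+1).+1 Inv.
Proof.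
move=> step Ia; rewrite /while.
(* The loop counter [n] decreases, while the body keeps running with the original [fuel], so the two
   are separated before the induction. *)
suff H n b : Inv b -> mu b < n ->
    within (while_fuel (fun b => op (guard b)) body n b) (mu b * c.+1).+1 Inv.
  by move=> lt_a; have [b [d [e le_d Ib]]] := H _ _ Ia lt_a; exists b, d.
elim: n b => [//|n IHn] b Ib lt_b /=.
apply: within_bind_op; case: ifP => gb; last exact: within_ret.
have [b' [x [eb' xc [Ib' lt_b']]]] := step b Ib gb.
have [|r [y [er yc Ir]]] := IHn b' Ib'; first by lia.
exists r, (x + y); rewrite /bind eb' er; split=> //.
by apply: leq_trans (leq_add xc yc) _; nia.
Qed.

End CostLogic.

(** * Degree sums and connectedness *)

Section GraphFacts.
Local Open Scope nat_scope.
Variables (V : finType) (adj : rel V).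

(** Double counting: the degrees add up to the number of ordered adjacent pairs, and the fibre of
    the map to edges over {x, y} contains at most (x, y) and (y, x). *)
Lemma sum_deg_le : \sum_v #|adj v| <= 2 * #|edges adj|.
Proof.
pose D := [set xy : V * V | adj xy.1 xy.2].
pose f (xy : V * V) := [set xy.1; xy.2].
have -> : \sum_v #|adj v| = \sum_(xy in D) 1.
  under eq_bigr do rewrite -sum1_card.
  by rewrite pair_big_dep; apply: eq_bigl => xy; rewrite inE.
have -> : edges adj = f @: D.
  by apply/setP => e; apply/imsetP/imsetP => -[xy];
    rewrite ?inE => xyD ->; exists xy; rewrite ?inE.
rewrite (partition_big_imset f) mulnC -sum_nat_const.
apply: leq_sum => _ /imsetP[[x y] _ ->].
rewrite sum1dep_card.
have /subset_leq_card le2 : [set i in D | f i == f (x, y)]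
    \subset [set (x, y); (y, x)].
  apply/subsetP => -[a b]; rewrite !inE /f /= => /andP[_ /eqP e].
  have : a \in [set x; y] by rewrite -e set21.
  have : b \in [set x; y] by rewrite -e set22.
  have : x \in [set a; b] by rewrite e set21.
  have : y \in [set a; b] by rewrite e set22.
  rewrite !inE !xpair_eqE.
  by do 4![case/orP => /eqP ?]; subst; rewrite ?eqxx ?orbT.
by apply: leq_trans le2 _; rewrite cards2; case: eqP.
Qed.

Hypotheses (adj_sym : symmetric adj) (adj_conn : connected_graph adj).

(** If no edge left [S], then [S] would be closed under adjacency and, containing [u], would contain
    everything connected to [u], that is, all of [V]. *)
Lemma connected_exit (S : {set V}) (u : V) :
  u \in S -> #|S| < #|V| ->
  exists v w, [/\ v \notin S, w \in S & adj v w].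
Proof.
move=> uS ltS.
have [z zS] : exists z, z \notin S.
  apply/existsP; rewrite -negb_forall; apply: contraTN ltS => /forallP allS.
  by rewrite -leqNgt -cardsT subset_leq_card //; apply/subsetP => z _; apply: allS.
case: (boolP [exists v, [exists w, [&& v \notin S, w \in S & adj v w]]]).
  by move=> /existsP[v /existsP[w /and3P[]]]; exists v, w.
move=> /existsPn noexit; case/negP: zS.
have clS : closed adj (mem S).
  apply: intro_closed => [|x y xy xS].
    exact: sym_connect_sym.
  have /existsPn/(_ x) := noexit y.
  by rewrite [x \in S]xS adj_sym xy !andbT negbK.
by rewrite -(closed_connect clS (adj_conn u z)).
Qed.

(** An edge leaving the singleton of [v] makes every degree positive, so the degree sum is at least
    the number of vertices. *)
Lemma card_le_edges : 1 < #|V| -> #|V| <= 2 * #|edges adj|.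
Proof.
move=> V1; apply: leq_trans sum_deg_le; rewrite -sum1_card.
apply: leq_sum => v _.
have [||x [w [xv /set1P -> xadj]]] := @connected_exit [set v] v.
- exact: set11.
- by rewrite cards1.
by apply/card_gt0P; exists x; rewrite -topredE /= adj_sym.
Qed.

End GraphFacts.

(** * Cost and termination of Algorithm 1 *)

Section Alg1.
Local Open Scope nat_scope.
Variables (R : realType) (V : finType) (adj : rel V) (eps : {set V} -> R).
Variable fuel : nat.


Lemma update_min_within (m : option R) (y : R) :
  within fuel (update_min m y) 1 isSome.
Proof.
by case: m => [z|]; [apply: within_bind_op|]; apply: within_ret.
Qed.

(** For [v] outside [S] and symmetric [adj], this is membership in [nbhd adj S], oriented as in the
    scan of the adjacency list of [v]. *)
Definition exposed (S : {set V}) (v : V) : Prop :=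
  exists2 w, w \in S & adj v w.

(** Only the presence of a minimum is tracked, not its value: this is what decides whether the main
    loop can get stuck. *)
Lemma alpha_star_within (S : {set V}) (A : V -> R) (v : V) :
  within fuel (alpha_star adj eps S A v) (#|adj v| * 6).+1
    (fun m => exposed S v -> m).
Proof.
rewrite cardE.
pose Inv (s : seq V) (m : option R) :=
  forall w, w \in S -> adj v w -> (w \in s) || m.
suff: within fuel (alpha_star adj eps S A v) (size (adj_list adj v) * 6).+1
    (Inv [::]).
  by move/within_weaken; apply=> // m Hm [w wS vw]; apply: Hm vw.
apply: within_foreach_const => [w s m Im|w _ vw]; last first.
  by rewrite mem_enum [w \in _]vw.
apply: within_bind_op; case: ifP => wS.
  do 3!apply: within_bind_op.
  apply: within_weaken (update_min_within _ _) _ _ => // m' m'1 x _ _.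
  by rewrite m'1 orbT.
apply: within_ret => x xS vx; have := Im x xS vx; rewrite inE.
by case: eqP => // xw; rewrite -xw xS in wS.
Qed.

(** The first property makes the selected vertex new; the second guarantees that there is something
    to select. *)
Lemma all_alpha_star_within (S : {set V}) (A : V -> R) :
  within fuel (all_alpha_star adj eps S A)
    (#|V| + (\sum_v (#|adj v| * 6 + 4)).+1)
    (fun t => (forall v, t v -> v \notin S) /\
      (forall v, v \notin S -> exposed S v -> t v)).
Proof.
pose Inv (s : seq V) (t : V -> option R) := (forall v, t v -> v \notin S) /\
  (forall v, v \notin S -> exposed S v -> (v \in s) || t v).
apply: (within_bind (P := eq (fun _ => None))).
  by exists (fun _ => None), #|V|.
move=> _ <-.
suff: within fuel (foreach (enum V) (fun=> None) (fun v astar =>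
    let* inS := op (v \in S) in
    if inS then ret astar else
      let* m := alpha_star adj eps S A v in write astar v m))
    (\sum_(v <- enum V) (#|adj v| * 6 + 3).+1).+1 (Inv [::]).
  move/within_weaken; apply=> //; rewrite big_enum /=.
  by rewrite (eq_bigr _ (fun v _ => addnS _ _)).
apply: within_foreach => [v s t [t0 t1]|]; last first.
  by split=> // v _ _; rewrite mem_enum.
have -> : #|adj v| * 6 + 3 = ((#|adj v| * 6).+1 + 1).+1 by lia.
apply: within_bind_op; case: ifP => vS.
  apply: within_ret; split=> // w wS wx; have := t1 w wS wx; rewrite inE.
  by case: eqP => // wv; rewrite -wv (negPf wS) in vS.
apply: within_bind (alpha_star_within S A v) _ => m Hm.
apply: within_op; split=> w; first by case: eqP => [->|_ /t0] //; rewrite vS.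
move=> wS wx; have := t1 w wS wx; rewrite inE; case: eqP => [wv _|] //.
by rewrite Hm ?orbT // -wv.
Qed.

(** Minimality does not enter the invariant, so the argument is uniform in [tie]. *)
Lemma argmin_within (tie : tie_rule V) (S : {set V}) (t : V -> option R) :
  within fuel (argmin tie S t) (#|V| * 4).+1
    (fun best => (forall v, t v -> best) /\
      (forall v a, best = Some (v, a) -> t v)).
Proof.
pose Inv (s : seq V) (best : option (V * R)) :=
  (forall v, t v -> (v \in s) || best) /\
  (forall v a, best = Some (v, a) -> t v).
suff: within fuel (argmin tie S t) (size (enum V) * 4).+1 (Inv [::]).
  by rewrite -cardE.
apply: within_foreach_const => [v s best [b1 b2]|]; last first.
  by split=> // v _; rewrite mem_enum.
apply: within_bind_op; case tv: (t v) => [a|]; last first.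
  apply: within_ret; split=> // w tw; have := b1 w tw; rewrite inE.
  by case: eqP => // wv; rewrite wv tv in tw.
case: best b1 b2 => [[w b]|] b1 b2.
  do 2!apply: within_bind_op; apply: within_ret; split=> [x _|x y].
    by case: ifP; rewrite orbT.
  by case: ifP => _ [<- _]; [rewrite tv | apply: b2 (erefl _)].
by apply: within_ret; split=> [x _|x y [<- _]]; [rewrite orbT | rewrite tv].
Qed.

Hypotheses (adj_sym : symmetric adj) (adj_conn : connected_graph adj).

(** Membership of [u] allows [connected_exit] to be applied; the equation turns the guard on the
    counter into one on the size of the set. *)
Definition loop_inv (u : V) (st : {set V} * (V -> R) * nat) : Prop :=
  u \in st.1.1 /\ #|st.1.1| = st.2.

Definition body_cost : nat :=
  #|V| + (\sum_v (#|adj v| * 6 + 4)).+1 + ((#|V| * 4).+1 + 3).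

(** An edge leaving [S] yields an exposed vertex, so [argmin] returns some vertex and the body is
    not stuck. That vertex lies outside [S], so size and counter grow together. *)
Lemma alg1_body_within (tie : tie_rule V) (u : V) st :
  loop_inv u st -> st.2 < #|V| ->
  within fuel (alg1_body adj eps tie st) body_cost
    (fun st' => loop_inv u st' /\ #|V| - st'.2 < #|V| - st.2).
Proof.
case: st => [[S A] i] [/= uS cardS] lt_i.
apply: within_bind (all_alpha_star_within S A) _ => t [t0 t1].
apply: within_bind (argmin_within tie S t) _ => best [b1 b2].
have [|x [w [xS wS xw]]] := connected_exit adj_sym adj_conn uS.
  by rewrite cardS.
have := b1 x (t1 x xS (ex_intro2 _ _ w wS xw)).
case: best b1 b2 => // -[v a] _ /(_ v a erefl)/t0 vS _.
do 3!apply: within_bind_op; apply: within_ret; split; last by rewrite /=; lia.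
by split; rewrite /= ?inE ?uS ?orbT // cardsU1 vS cardS.
Qed.

End Alg1.

Lemma alg1_within (R : realType) (V : finType) (adj : rel V)
    (eps : {set V} -> R) (tie : tie_rule V) (u : V) (alpha : R) :
  symmetric adj -> connected_graph adj ->
  within #|V|.+1 (alg1 adj eps tie u alpha)
    (100 * maxn 1 (#|edges adj| * #|V|))%N (fun=> True).
Proof.
move=> adj_sym adj_conn.
have V0 : (0 < #|V|)%N by apply/card_gt0P; exists u.
suff: within #|V|.+1 (alg1 adj eps tie u alpha)
    (#|V| + (#|V| + (((#|V| - 1) * (body_cost adj).+1).+1 + 0).+2).+1)%N
    (fun=> True).
  move/within_weaken; apply=> //.
  rewrite /body_cost big_split /= -big_distrl /= sum_nat_const.
  have := sum_deg_le adj; have := card_le_edges adj_sym adj_conn.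
  (* A single vertex needs no iteration, and [maxn 1] absorbs the constant setup cost. Otherwise an
     iteration with its guard costs 9|V| + 6d + 6, at most 36e since |V| and d are at most 2e and e
     is positive. *)
  move: (\sum_v _)%N #|V| #|edges adj| V0 => d [//|[|n]] e _.
    by move=> _ _; lia.
  by move=> /(_ isT) ne de; nia.
apply: (within_bind (P := eq set0)); first by exists set0, #|V|.
move=> _ <-; apply: within_bind_op.
apply: (within_bind (P := eq (fun=> 0))); first by exists (fun=> 0), #|V|.
move=> _ <-; do 2!apply: within_bind_op.
apply: within_bind => [|st _]; last exact: within_ret.
pose mu (st : {set V} * (V -> R) * nat) := (#|V| - st.2)%N.
apply: (within_while (Inv := loop_inv u) (mu := mu)
  (guard := fun st => st.2 < #|V|)%N).
- move=> st ust lt_st.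
  exact: (alg1_body_within _ _ adj_sym adj_conn).
- by split; rewrite /= setU0 ?set11 ?cards1.
- by rewrite /mu ltnS leq_subr.
Qed.

(** * Cost of Algorithm 2 *)

Section Alg2.
Local Open Scope nat_scope.
Variables (R : realType) (V : finType) (adj : rel V) (eps : {set V} -> R).
Hypotheses (adj_sym : symmetric adj) (adj_conn : connected_graph adj).
Variable tie : V -> V -> tie_rule V.

Let call_cost := 100 * maxn 1 (#|edges adj| * #|V|).

Lemma compatible_within (S : {set V}) (p : V -> R) :
  within #|V|.+1 (compatible adj eps tie S p)
    (#|S| * (#|S| * (call_cost + 6)).+2).+1 (fun=> True).
Proof.
rewrite [#|S|]cardE.
apply: (within_foreach_const (Inv := fun _ _ => True)) => // u _ ok _.
have -> : call_cost + 6 = (call_cost + 3).+3 by lia.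
apply: (within_foreach_const (Inv := fun _ _ => True)) => // v _ {}ok _.
apply: within_bind_op; case: ifP => _; last exact: within_ret.
apply: within_bind_op; apply: within_bind.
  exact: alg1_within.
by move=> A _; do 3!apply: within_bind_op; apply: within_ret.
Qed.

(** The budget 2 for [alpha] covers both uses: reading p(u), and reading it before computing 1 -
    p(u). *)
Lemma min_over_within (S : {set V}) (alpha : V -> Defs.comp R) (v : V) :
  (forall u, within #|V|.+1 (alpha u) 2 (fun=> True)) ->
  within #|V|.+1 (min_over adj eps tie S alpha v)
    ((#|S| * (call_cost + 5)).+1 + 0) (fun=> True).
Proof.
move=> alpha2; apply: within_bind => [|m _]; last exact: within_ret.
rewrite cardE; have -> : call_cost + 5 = (2 + (call_cost + 2)).+1 by lia.
apply: (within_foreach_const (Inv := fun _ _ => True)) => // u _ m _.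
apply: within_bind (alpha2 u) _ => a _.
apply: within_bind.
  exact: alg1_within.
move=> A _; apply: within_bind_op.
exact: within_weaken (update_min_within _ _ _) _ _.
Qed.

Lemma alg2_within (T : V -> nat) (S : {set V}) (p : V -> R) :
  within #|V|.+1 (alg2 adj eps tie T S p)
    (1000 * maxn 1 (#|V| ^ 3 * #|edges adj|)) (fun=> True).
Proof.
(* [M] is the cost of one minimum. Each vertex adds at most a loop step, two tests, a subtraction
   and a write. *)
pose M := (#|S| * (call_cost + 5)).+1 + 0.
suff: within #|V|.+1 (alg2 adj eps tie T S p)
    ((#|S| * (#|S| * (call_cost + 6)).+2).+1 +
     (#|V| + ((#|V| * (M + 2).+3).+1 + 0))) (fun=> True).
  move/within_weaken; apply=> //; rewrite {}/M /call_cost.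
  have := card_le_edges adj_sym adj_conn; have := max_card (mem S).
  move: #|S| #|V| #|edges adj| => s n e sn ne.
  set X := maxn 1 (e * n); set Y := maxn 1 (n ^ 3 * e).
  (* The at most 2n^2 calls cost O(X) each, so it remains to compare n^2 X with Y. For n at least 2
     there is an edge, so X = e n and n^2 X = n^3 e; the cases n = 0 and n = 1 are separate because
     e may vanish there. *)
  have [nnX nn] : n * n * X <= Y /\ n * n <= Y.
    case: n sn ne @X @Y => [|[|n]] sn ne X Y; [by lia|by lia|].
    have e0 : 0 < e by have := ne isT; lia.
    have -> : X = e * n.+2 by rewrite /X; nia.
    have le : n.+2 ^ 3 * e <= Y by rewrite leq_maxr.
    rewrite !expnS expn0 in le; split; first by lia.
    by apply: leq_trans le; rewrite mulnA muln1 mulnAC -mulnA leq_pmulr //; lia.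
  have Y1 : 1 <= Y by rewrite leq_maxl.
  have ss : s * s <= n * n by rewrite leq_mul.
  have sns : n * s <= n * n by rewrite leq_mul.
  have ssX : s * s * X <= n * n * X by rewrite leq_mul.
  have snX : n * s * X <= n * n * X by rewrite leq_mul.
  have nY : n <= Y by nia.
  (* With [X] and [Y] opaque, the goal is linear in the products bounded above. *)
  by clearbody X Y; lia.
apply: within_bind (compatible_within S p) _ => -[] _; last exact: within_ret.
apply: (within_bind (P := fun=> True)); first by exists (fun=> 0%R), #|V|.
move=> pt0 _; apply: within_bind => [|pt _]; last exact: within_ret.
rewrite [X in X * _]cardT.
apply: (within_foreach_const (Inv := fun _ _ => True)) => // v _ pt _.
apply: within_bind_op; case: ifP => _.
  by apply: within_bind_op; apply: within_op.
apply: within_bind_op; case: ifP => _.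
  apply: within_bind.
    by apply: min_over_within => u; apply: within_op.
  by move=> m _; apply: within_op.
apply: within_bind.
  by apply: min_over_within => u; apply: within_bind_op; apply: within_op.
by move=> m _; apply: within_bind_op; apply: within_op.
Qed.

End Alg2.

Theorem theorem5 (R : realType) :
  (exists C : nat,
     forall (V : finType) (adj : rel V) (eps : {set V} -> R),
       symmetric adj -> irreflexive adj -> connected_graph adj ->
       (forall e, e \in edges adj -> 0 <= eps e) ->
     forall (tie : tie_rule V) (u : V) (alpha : R),
       0 <= alpha <= 1 ->
       runs_within (alg1 adj eps tie u alpha)
         (C * maxn 1 (#|edges adj| * #|V|))%N)
  /\
  (exists C : nat,
     forall (V : finType) (adj : rel V) (eps : {set V} -> R),
       symmetric adj -> irreflexive adj -> connected_graph adj ->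
       (forall e, e \in edges adj -> 0 <= eps e) ->
     forall (tie : V -> V -> tie_rule V) (T : V -> nat) (S : {set V})
            (p : V -> R),
       (forall v, T v \in [:: 1%N; 2%N]) ->
       boundary adj T \subset S ->
       (forall v, v \in S -> 0 <= p v <= 1) ->
       runs_within (alg2 adj eps tie T S p)
         (C * maxn 1 (#|V| ^ 3 * #|edges adj|))%N).
Proof.
split.
  exists 100%N => V adj eps adj_sym _ adj_conn _ tie u alpha _.
  exact: within_runs (alg1_within _ _ _ _ adj_sym adj_conn) _.
exists 1000%N => V adj eps adj_sym _ adj_conn _ tie T S p _ _ _.
exact: within_runs (alg2_within _ adj_sym adj_conn _ _ _ _) _.
Qed.
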